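(* Let $G$ be a graph and $P_n$ the path on $n$ vertices, and assume $P_n \boxtimes G$ has a separated stack layout on $s$ stacks. Then $G$ admits a simultaneous $s$-stack $s^2$-queue layout, and therefore the pathwidth of $G$ is at most $2s^3$.
   Context: All graphs are finite, simple and undirected. A vertex order $\sigma$ is a total order of the vertices. Two edges $(u,v)$ and $(x,y)$ cross with respect to $\sigma$ if $u <_\sigma x <_\sigma v <_\sigma y$, and nest if $u <_\sigma x <_\sigma y <_\sigma v$. A $k$-stack layout is a vertex order with a partition of the edges into $k$ sets of pairwise non-crossing edges. A simultaneous $s$-stack $q$-queue layout of $G$ is a single vertex order together with a partition of $E(G)$ into $s$ sets of pairwise non-crossing edges and a partition of $E(G)$ into $q$ sets of pairwise non-nested edges, both with respect to that order. The strong product $P_n\boxtimes G$ has vertex set $V(P_n)\times V(G)$, with $(v,x)$ and $(u,y)$ adjacent iff either ($v=u$ and $(x,y)\in E(G)$), or ($x=y$ and $(v,u)\in E(P_n)$), or ($(v,u)\in E(P_n)$ and $(x,y)\in E(G)$). For each vertex $v$ of $P_n$, the copy $G_v$ of $G$ is the subgraph induced by $\{(v,x): x\in V(G)\}$; copies $G_v, G_u$ are consecutive if $(v,u)\in E(P_n)$. A stack layout of $P_n\boxtimes G$ is separated if for at least two consecutive copies $G_1,G_2$ of $G$, all vertices of $G_1$ precede all vertices of $G_2$ in the vertex order. Pathwidth is the minimum width (maximum bag size minus one) of a path decomposition. *)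

(* Defs.v *)
From mathcomp Require Import all_boot.
From mathcomp Require Import boolp.

Set Implicit Arguments.
Unset Strict Implicit.
Unset Printing Implicit Defensive.

Record sgraph := SGraph {
  vertex :> finType;
  adj : rel vertex;
  adj_sym : symmetric adj;
  adj_irr : irreflexive adj }.

Definition edges (G : sgraph) : {set {set G}} :=
  [set [set p.1; p.2] | p : G * G & adj p.1 p.2].

Section Path.
Variable n : nat.

Definition path_adj : rel 'I_n :=
  fun i j => (i.+1 == j :> nat) || (j.+1 == i :> nat).

Lemma path_adj_sym : symmetric path_adj.
Proof. by move=> i j; rewrite /path_adj orbC. Qed.

Lemma path_adj_irr : irreflexive path_adj.
Proof. by move=> i; rewrite /path_adj orbb -[X in _ == X]add0n -add1n eqn_add2r. Qed.

Definition path_graph : sgraph := SGraph path_adj_sym path_adj_irr.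

End Path.

Section StrongProduct.
Variables H G : sgraph.

Definition strong_adj : rel (H * G) := fun p q =>
  [|| (p.1 == q.1) && adj p.2 q.2,
      (p.2 == q.2) && adj p.1 q.1
    | adj p.1 q.1 && adj p.2 q.2].

Lemma strong_adj_sym : symmetric strong_adj.
Proof.
move=> p q; rewrite /strong_adj (eq_sym p.1) (eq_sym p.2).
by rewrite (adj_sym p.1) (adj_sym p.2).
Qed.

Lemma strong_adj_irr : irreflexive strong_adj.
Proof. by move=> p; rewrite /strong_adj !adj_irr !andbF. Qed.

Definition strong_product : sgraph := SGraph strong_adj_sym strong_adj_irr.

End StrongProduct.

Section Layouts.
Variable G : sgraph.

(* [total] includes reflexivity, so [r] is the non-strict order; its strict
   part is [slt r]. *)
Definition vertex_order (r : rel G) : Prop :=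
  [/\ total r, antisymmetric r & transitive r].

Definition slt (r : rel G) (x y : G) : bool := (x != y) && r x y.

(* Neither relation is symmetric in its two edges: [f] is the edge with the
   leftmost endpoint.  The layouts below quantify over ordered pairs. *)
Definition cross (r : rel G) (f g : {set G}) : Prop :=
  exists u v x y : G, [/\ f = [set u; v], g = [set x; y] &
    [/\ slt r u x, slt r x v & slt r v y]].

Definition nest (r : rel G) (f g : {set G}) : Prop :=
  exists u v x y : G, [/\ f = [set u; v], g = [set x; y] &
    [/\ slt r u x, slt r x y & slt r y v]].

(* Parts may be empty, so a partition into k sets is also one into k' >= k. *)
Definition edge_partition (k : nat) (P : 'I_k -> {set {set G}}) : Prop :=
  \bigcup_i P i = edges G /\ forall i j, i != j -> [disjoint P i & P j].

Definition stack_partition (r : rel G) (k : nat) (P : 'I_k -> {set {set G}}) :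
    Prop :=
  edge_partition P /\
  forall i f g, f \in P i -> g \in P i -> ~ cross r f g.

Definition queue_partition (r : rel G) (k : nat) (P : 'I_k -> {set {set G}}) :
    Prop :=
  edge_partition P /\
  forall i f g, f \in P i -> g \in P i -> ~ nest r f g.

Definition stack_layout (k : nat) (r : rel G) (P : 'I_k -> {set {set G}}) :
    Prop :=
  vertex_order r /\ stack_partition r P.

Definition has_simultaneous_layout (s q : nat) : Prop :=
  exists (r : rel G) (S : 'I_s -> {set {set G}}) (Q : 'I_q -> {set {set G}}),
    [/\ vertex_order r, stack_partition r S & queue_partition r Q].

End Layouts.

Definition separated (n : nat) (G : sgraph)
    (r : rel (strong_product (path_graph n) G)) : Prop :=
  exists v u : path_graph n,
    adj v u /\ forall x y : G, slt r (v, x) (u, y).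

Definition has_separated_stack_layout (n : nat) (G : sgraph) (s : nat) : Prop :=
  exists (r : rel (strong_product (path_graph n) G))
         (P : 'I_s -> {set {set strong_product (path_graph n) G}}),
    stack_layout r P /\ separated r.

Section Pathwidth.
Variable G : sgraph.

Definition path_decomposition (B : seq {set G}) : Prop :=
  [/\ forall x : G, exists2 b, b \in B & x \in b,
      forall x y : G, adj x y -> exists2 b, b \in B & (x \in b) && (y \in b)
    & forall i j k : nat, i <= j -> j <= k -> k < size B ->
        nth set0 B i :&: nth set0 B k \subset nth set0 B j].

(* Truncated subtraction: the graph without vertices gets width 0, not -1. *)
Definition width (B : seq {set G}) : nat := (\max_(b <- B) #|b|).-1.

Lemma ex_path_decomposition :
  exists w, `[< exists2 B, path_decomposition B & width B = w >].
Proof.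
exists (width [:: [set: G]]); apply/asboolP; exists [:: [set: G]] => //.
split=> [x|x y _|i j k ij jk].
- by exists setT; rewrite ?mem_seq1 ?inE.
- by exists setT; rewrite ?mem_seq1 ?inE.
rewrite ltnS leqn0 => /eqP k0; move: jk; rewrite k0 leqn0 => /eqP ->.
by rewrite subsetIr.
Qed.

Definition pathwidth : nat := ex_minn ex_path_decomposition.

End Pathwidth.

(* Main.v *)
(* Let the copy of G at v precede the copy at u.  The edges (v,x)(u,x) on one
   stack are nested, so their endpoints occur in opposite orders in the two
   copies.  Take the order of the copy at v, and put an edge x < y in the queue
   indexed by the stacks of (v,y)(u,y) and of (v,x)(u,y): for a nested pair
   a < x < y < b in one queue, the first index puts (u,b) before (u,y), and then
   (v,a)(u,b) and (v,x)(u,y) cross on one stack.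

   For the pathwidth, intersect the stacks with the queues to get s * s^2 classes
   in which no two edges cross or nest.  The bags are indexed by the vertices w
   in the layout order, and each class adds at most two vertices to bag w. *)

Require Import Defs.
From mathcomp Require Import all_boot.
From mathcomp Require Import boolp.

Set Implicit Arguments.
Unset Strict Implicit.
Unset Printing Implicit Defensive.

(** * Edges as unordered pairs, and edge partitions *)

Lemma mem_edges (G : sgraph) (x y : G) :
  ([set x; y] \in edges G) = adj x y.
Proof.
apply/imsetP/idP => [[[a b] /= ab] e|xy]; last by exists (x, y); rewrite ?inE.
rewrite inE /= in ab.
have nab : a != b by apply: contraTneq ab => ->; rewrite adj_irr.
have /set2P xs : x \in [set a; b] by rewrite -e set21.
have /set2P ys : y \in [set a; b] by rewrite -e set22.
have /set2P a_xy : a \in [set x; y] by rewrite e set21.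
have /set2P b_xy : b \in [set x; y] by rewrite e set22.
(* Of the four ways to match [x], [y] with [a], [b], the two with [x = y] would collapse
   [[set a; b]] to a singleton. *)
case: xs ys => ? [] ?; subst x y => //.
- by case: b_xy nab => ->; rewrite eqxx.
- by rewrite adj_sym.
- by case: a_xy nab => ->; rewrite eqxx.
Qed.

Lemma edgesP (G : sgraph) (e : {set G}) :
  reflect (exists x y : G, e = [set x; y] /\ adj x y) (e \in edges G).
Proof.
apply: (iffP imsetP) => [[[x y]]|[x [y [-> xy]]]]; last by exists (x, y); rewrite ?inE.
by rewrite inE /= => xy ->; exists x, y.
Qed.

Lemma edge_partition_cover (G : sgraph) (k : nat) (P : 'I_k -> {set {set G}})
    (x y : G) :
  edge_partition P -> adj x y -> exists i, [set x; y] \in P i.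
Proof.
by case=> cP _; rewrite -mem_edges -cP => /bigcupP[i _ xyi]; exists i.
Qed.

Lemma edge_partition_inj (G : sgraph) (k : nat) (P : 'I_k -> {set {set G}})
    (e : {set G}) (i j : 'I_k) :
  edge_partition P -> e \in P i -> e \in P j -> i = j.
Proof.
move=> [_ dP] ei ej; apply/eqP/negPn/negP => /dP /disjointFr /(_ ei).
by rewrite ej.
Qed.

(** * Strict part of a vertex order *)

Section Slt.
Variables (G : sgraph) (r : rel G).
Hypothesis order_r : vertex_order r.

Lemma slt_neq (x y : G) : slt r x y -> x != y.
Proof. by case/andP. Qed.

Lemma slt_trans (y x z : G) : slt r x y -> slt r y z -> slt r x z.
Proof.
case: order_r => _ rA rT /andP[nxy xy] /andP[nyz yz].
rewrite /slt (rT _ _ _ xy yz) andbT; apply: contraNneq nxy => e.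
by apply/eqP/rA; rewrite xy e.
Qed.

Lemma slt_le_trans (y x z : G) : slt r x y -> r y z -> slt r x z.
Proof.
move=> xy yz; have [<- //|nyz] := eqVneq y z.
by apply: (slt_trans xy); rewrite /slt nyz.
Qed.

Lemma le_slt_trans (y x z : G) : r x y -> slt r y z -> slt r x z.
Proof.
move=> xy yz; have [-> //|nxy] := eqVneq x y.
by apply: (slt_trans _ yz); rewrite /slt nxy.
Qed.

Lemma slt_total (x y : G) : x != y -> slt r x y \/ slt r y x.
Proof.
case: order_r => rt _ _ nxy; rewrite /slt (eq_sym y x) nxy.
exact/orP/rt.
Qed.

Lemma slt_asym (x y : G) : slt r x y -> slt r y x -> False.
Proof. by move=> xy /(slt_trans xy)/slt_neq; rewrite eqxx. Qed.

(** An unordered pair has only one increasing orientation, so an edge can be treated as an ordered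
    pair. *)
Lemma slt_pair_inj (a b x y : G) :
  slt r a b -> slt r x y -> [set a; b] = [set x; y] -> a = x /\ b = y.
Proof.
move=> ab xy e.
have : x \in [set a; b] by rewrite e set21.
have : y \in [set a; b] by rewrite e set22.
rewrite !inE => /orP[]/eqP ey /orP[]/eqP ex; subst => //.
- by have := slt_neq xy; rewrite eqxx.
- by case: (slt_asym ab xy).
- by have := slt_neq xy; rewrite eqxx.
Qed.

Lemma edges_sltP (e : {set G}) :
  e \in edges G -> exists x y : G, [/\ e = [set x; y], adj x y & slt r x y].
Proof.
case/edgesP=> x [y [-> xy]].
have /slt_total[lt|lt] : x != y by apply: contraTneq xy => ->; rewrite adj_irr.
  by exists x, y.
by exists y, x; rewrite setUC adj_sym.
Qed.

End Slt.

(** * Path decomposition from edge classes without crossings or nestings *)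

Section ForestDecomposition.
Variables (G : sgraph) (r : rel G) (I : finType) (F : I -> {set {set G}}).
Hypothesis order_r : vertex_order r.
Hypothesis cover_F : forall x y : G, adj x y -> exists i, [set x; y] \in F i.
Hypothesis no_cross : forall i f g, f \in F i -> g \in F i -> ~ cross r f g.
Hypothesis no_nest : forall i f g, f \in F i -> g \in F i -> ~ nest r f g.

Definition right_nbr (i : I) (x y : G) : bool :=
  slt r x y && ([set x; y] \in F i).

(* Each edge [x < y] of a class is covered by extending [x] forward to [y] when
   [x] has several right neighbours in the class, and [y] back to [x] otherwise. *)
Definition forward_active (i : I) (w : G) : {set G} :=
  [set x | slt r x w && [exists a, exists b,
    [&& right_nbr i x a, right_nbr i x b, slt r a b & r w b]]].

Definition backward_active (i : I) (w : G) : {set G} :=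
  [set y | slt r w y && [exists x,
    [&& r x w, right_nbr i x y & [forall z, right_nbr i x z ==> (z == y)]]]].

Definition bag (w : G) : {set G} :=
  w |: \bigcup_i (forward_active i w :|: backward_active i w).

Lemma nested_right_nbr (i : I) (x x' y y' : G) :
  right_nbr i x y -> right_nbr i x' y' -> slt r x x' -> slt r y' y -> False.
Proof.
move=> /andP[_ xy] /andP[x'y' xy'] xx' yy'.
by apply: (no_nest xy xy'); exists x, y, x', y'.
Qed.

Lemma crossing_right_nbr (i : I) (x x' y y' : G) :
  right_nbr i x y -> right_nbr i x' y' -> slt r x x' -> slt r x' y ->
  slt r y y' -> False.
Proof.
move=> /andP[_ xy] /andP[_ xy'] xx' x'y yy'.
by apply: (no_cross xy xy'); exists x, y, x', y'.
Qed.

(** If [y] comes before [y'] the two edges cross; if after, the second is nested in the first. *)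
Lemma overlapping_right_nbr (i : I) (x x' y y' : G) :
  right_nbr i x y -> right_nbr i x' y' -> slt r x x' -> slt r x' y -> y = y'.
Proof.
move=> xy xy' xx' x'y; apply/eqP/negPn/negP => /(slt_total order_r)[] lt.
  exact: (crossing_right_nbr xy xy').
exact: (nested_right_nbr xy xy').
Qed.

(** Suppose [x] before [x'] are both active. The far neighbour of [x] is at or beyond [w], hence
    beyond [x'], so both vertices share that far neighbour [b]. The edge from [x'] to its nearer
    neighbour is then nested in [x b]. *)
Lemma card_forward_active (i : I) (w : G) : #|forward_active i w| <= 1.
Proof.
have key x x' : x \in forward_active i w -> x' \in forward_active i w ->
    slt r x x' -> False.
  rewrite !inE => /andP[xw /existsP[a /existsP[b /and4P[xa xb ab wb]]]].
  case/andP=> x'w /existsP[a' /existsP[b' /and4P[xa' xb' ab' wb']]] xx'.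
  have eb := overlapping_right_nbr xb xb' xx' (slt_le_trans order_r x'w wb).
  by apply: (nested_right_nbr xb xa' xx'); rewrite eb.
apply/card_le1_eqP => x y xA yA; apply/eqP/negPn/negP.
by case/(slt_total order_r); apply: key.
Qed.

(** Two edges reaching over [w] from distinct left ends overlap and so share their right end; from a
    common left end, the uniqueness clause identifies the right ends. *)
Lemma card_backward_active (i : I) (w : G) : #|backward_active i w| <= 1.
Proof.
apply/card_le1_eqP => y y'; rewrite !inE.
case/andP=> wy /existsP[x /and3P[xw xy /forallP uy]].
case/andP=> wy' /existsP[x' /and3P[xw' xy' /forallP uy']].
have [exx|/(slt_total order_r)[] lt] := eqVneq x x'.
- by have := uy' y; rewrite -exx xy => /eqP.
- by rewrite (overlapping_right_nbr xy xy' lt (le_slt_trans order_r xw' wy)).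
- by rewrite (overlapping_right_nbr xy' xy lt (le_slt_trans order_r xw wy')).
Qed.

Lemma card_bag (w : G) : #|bag w| <= (2 * #|I|).+1.
Proof.
(* The successor pays for [w] itself; the rest becomes a sum of 2 over the classes. *)
rewrite (leq_trans (leq_card_setU _ _)) // cards1 ltnS mulnC -sum_nat_const.
elim/big_ind2: _ => [|A m B n Am Bn|i _]; first by rewrite cards0.
  exact: leq_trans (leq_card_setU _ _) (leq_add Am Bn).
apply: leq_trans (leq_card_setU _ _) _.
exact: leq_add (card_forward_active i w) (card_backward_active i w).
Qed.

(** A vertex [x] before [w] can lie in the later bag [z] only as forward active, and this persists
    when the bag moves back towards [x]. Symmetrically, a vertex after [w] is backward active at
    [u], and remains so until the bag reaches it. *)
Lemma bag_convex (u w z : G) : r u w -> r w z -> bag u :&: bag z \subset bag w.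
Proof.
have [_ _ rT] := order_r.
move=> uw wz; apply/subsetP => x /setIP[xu xz].
have [->|/(slt_total order_r)[] lt] := eqVneq x w; first exact: setU11.
- have xz' := slt_le_trans order_r lt wz.
  apply/setU1P; right; case/setU1P: xz => [e|/bigcupP[i _ xi]].
    by have := slt_neq xz'; rewrite e eqxx.
  apply/bigcupP; exists i => //; apply/setUP; left.
  move: xi; rewrite !inE lt => /orP[] /andP[lt'].
    move=> /existsP[a /existsP[b /and4P[xa xb ab zb]]].
    apply/existsP; exists a; apply/existsP; exists b.
    by rewrite xa xb ab (rT _ _ _ wz zb).
  by case: (slt_asym order_r lt' xz').
- have ux' := le_slt_trans order_r uw lt.
  apply/setU1P; right; case/setU1P: xu => [e|/bigcupP[i _ xi]].
    by have := slt_neq ux'; rewrite e eqxx.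
  apply/bigcupP; exists i => //; apply/setUP; right.
  move: xi; rewrite !inE lt => /orP[] /andP[lt'].
    by case: (slt_asym order_r lt' ux').
  move=> /existsP[a /and3P[au ax uni]].
  by apply/existsP; exists a; rewrite (rT _ _ _ au uw) ax uni.
Qed.

Lemma bag_edge (x y : G) :
  adj x y -> exists w, (x \in bag w) && (y \in bag w).
Proof.
have [rt _ _] := order_r; have rR z : r z z by have := rt z z; rewrite orbb.
have key a b : slt r a b -> adj a b -> exists w, (a \in bag w) && (b \in bag w).
  move=> lt /cover_F[i abi].
  have ab : right_nbr i a b by rewrite /right_nbr lt.
  case: (boolP [forall z, right_nbr i a z ==> (z == b)]) => [uni|].
    exists a; rewrite setU11; apply/setU1P; right.
    apply/bigcupP; exists i => //; apply/setUP; right.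
    by rewrite inE lt; apply/existsP; exists a; rewrite rR ab.
  case/forallPn=> c; rewrite negb_imply => /andP[ac ncb].
  (* With a second right neighbour [c], [a] is forward active at [b]: the later of [b] and [c] is at
     or beyond [b]. *)
  exists b; rewrite setU11 andbT; apply/setU1P; right.
  apply/bigcupP; exists i => //; apply/setUP; left; rewrite inE lt.
  case/(slt_total order_r): ncb => cb; apply/existsP.
    by exists c; apply/existsP; exists b; rewrite ac ab cb rR.
  exists b; apply/existsP; exists c; rewrite ab ac cb.
  by case/andP: cb.
move=> xy; have : x != y by apply: contraTneq xy => ->; rewrite adj_irr.
case/(slt_total order_r) => lt; first exact: key.
by rewrite adj_sym in xy; case: (key _ _ lt xy) => w; exists w; rewrite andbC.
Qed.

Lemma pathwidth_le_forests : pathwidth G <= 2 * #|I|.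
Proof.
have [rt _ rT] := order_r; have rR z : r z z by have := rt z z; rewrite orbb.
pose B := [seq bag w | w <- sort r (enum G)].
have bagB w : bag w \in B by rewrite map_f // mem_sort mem_enum.
have decB : path_decomposition B.
  split=> [x|x y /bag_edge[w wP]|i j k ij jk].
  - by exists (bag x); rewrite ?setU11.
  - by exists (bag w).
  rewrite size_map => ks.
  have x0 : G by case: (sort r (enum G)) ks => [|x].
  have js := leq_ltn_trans jk ks; have is_ := leq_ltn_trans ij js.
  rewrite !(nth_map x0) //.
  have srt := sort_sorted rt (enum G).
  by apply: bag_convex; apply: (sorted_leq_nth rT rR x0 srt).
rewrite /pathwidth; case: ex_minnP => m _ /(_ (width B)) le_m.
apply: leq_trans (le_m _) _; first by apply/asboolP; exists B.
(* The one subtracted in [width] absorbs the vertex [w] of its own bag. *)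
rewrite /width -subn1 leq_subLR add1n; apply/bigmax_leqP_seq => b /mapP[w _ ->] _.
exact: card_bag.
Qed.

End ForestDecomposition.

Lemma simultaneous_layout_pathwidth (G : sgraph) (s q : nat) :
  has_simultaneous_layout G s q -> pathwidth G <= 2 * (s * q).
Proof.
case=> r [S [Q [order_r [partS stackS] [partQ queueQ]]]].
have -> : s * q = #|{: 'I_s * 'I_q}| by rewrite card_prod !card_ord.
apply: (@pathwidth_le_forests G r _ (fun p => S p.1 :&: Q p.2)) => //.
- move=> x y xy; have [i xi] := edge_partition_cover partS xy.
  by have [j xj] := edge_partition_cover partQ xy; exists (i, j); rewrite inE xi.
- by move=> p f g /setIP[fS _] /setIP[gS _]; apply: stackS fS gS.
- by move=> p f g /setIP[_ fQ] /setIP[_ gQ]; apply: queueQ fQ gQ.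
Qed.

(** * Stacks and queues from two adjacent copies, the first preceding the second *)

Section SeparatedLayout.
Variables (G H : sgraph) (s : nat).
Variables (r : rel (strong_product H G)).
Variable P : 'I_s -> {set {set strong_product H G}}.
Hypothesis layout_P : stack_layout r P.
Variables v u : H.
Hypothesis adj_vu : adj v u.
Hypothesis v_before_u : forall x y : G, slt r (v, x) (u, y).

Let order_r : vertex_order r := layout_P.1.
Let part_P : edge_partition P := layout_P.2.1.

Definition copy_order : rel G := fun x y => r (v, x) (v, y).

Lemma slt_copy_order (x y : G) : slt copy_order x y = slt r (v, x) (v, y).
Proof. by rewrite /slt /copy_order xpair_eqE eqxx. Qed.

Lemma vertex_order_copy : vertex_order copy_order.
Proof.
have [rt rA rT] := order_r; split=> [x y|x y xy|y x z]; first exact: rt.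
  by case: (rA _ _ xy).
exact: rT.
Qed.

Definition copy_stack (i : 'I_s) : {set {set G}} :=
  [set e in edges G | [set ((v, x) : strong_product H G) | x in e] \in P i].

Lemma copy_set2 (x y : G) :
  [set ((v, z) : strong_product H G) | z in [set x; y]] = [set (v, x); (v, y)].
Proof. by rewrite imsetU !imset_set1. Qed.

Lemma stack_partition_copy : stack_partition copy_order copy_stack.
Proof.
split; first split.
- apply/setP => e; apply/bigcupP/idP => [[i _]|eG]; first by rewrite inE => /andP[].
  case/edgesP: (eG) => x [y [exy xy]].
  have : adj ((v, x) : strong_product H G) (v, y) by rewrite /= /strong_adj /= eqxx xy.
  case/(edge_partition_cover part_P)=> i xyi.
  by exists i => //; rewrite inE eG exy copy_set2.
- move=> i j nij; rewrite -setI_eq0; apply/set0Pn => -[e].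
  rewrite !inE => /andP[/andP[_ ei] /andP[_ ej]].
  by rewrite (edge_partition_inj part_P ei ej) eqxx in nij.
move=> i f g; rewrite !inE => /andP[_ fi] /andP[_ gi] [a [b [x [y [ef eg]]]]].
rewrite !slt_copy_order => -[lt1 lt2 lt3].
apply: (layout_P.2.2 i _ _ fi gi).
by exists (v, a), (v, b), (v, x), (v, y); rewrite ef eg !copy_set2.
Qed.

(** This pair is an edge of the product exactly when [x = y] or [x] and [y] are adjacent. *)
Definition link (x y : G) : {set strong_product H G} := [set (v, x); (u, y)].

(** Edges are unordered, so the endpoints are quantified and [slt copy_order x y] fixes which of
    them is [y], the end used in both links. *)
Definition twist_class (p : 'I_s * 'I_s) : {set {set G}} :=
  [set e in edges G | [exists x, exists y,
    [&& e == [set x; y], slt copy_order x y,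
        link y y \in P p.1
      & link x y \in P p.2]]].

Lemma twist_classP (p : 'I_s * 'I_s) (x y : G) :
  slt copy_order x y -> [set x; y] \in twist_class p ->
  link y y \in P p.1 /\
  link x y \in P p.2.
Proof.
move=> xy; rewrite inE => /andP[_ /existsP[a /existsP[b]]].
case/and4P=> /eqP e ab m1 m2.
by have [-> ->] := slt_pair_inj vertex_order_copy xy ab e.
Qed.

Lemma twist_class_cover (e : {set G}) :
  e \in edges G -> exists p, e \in twist_class p.
Proof.
move=> eG; have [x [y [exy xy lt]]] := edges_sltP vertex_order_copy eG.
have : adj ((v, y) : strong_product H G) (u, y).
  by rewrite /= /strong_adj /= eqxx adj_vu orbT.
case/(edge_partition_cover part_P)=> i yi.
have : adj ((v, x) : strong_product H G) (u, y).
  by rewrite /= /strong_adj /= adj_vu xy !orbT.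
case/(edge_partition_cover part_P)=> j xj.
exists (i, j); rewrite inE eG; apply/existsP; exists x; apply/existsP; exists y.
by rewrite exy eqxx lt yi.
Qed.

Lemma twist_class_inj (e : {set G}) (p q : 'I_s * 'I_s) :
  e \in twist_class p -> e \in twist_class q -> p = q.
Proof.
move=> ep; have : e \in edges G by move: ep; rewrite inE => /andP[].
case/(edges_sltP vertex_order_copy) => x [y [exy _ lt]].
move: ep; rewrite exy => /(twist_classP lt)[p1 p2] /(twist_classP lt)[q1 q2].
apply/eqP; rewrite -pair_eqE /=.
by rewrite (edge_partition_inj part_P p1 q1) (edge_partition_inj part_P p2 q2) !eqxx.
Qed.

(** Otherwise [(v, x)], [(v, y)], [(u, x)], [(u, y)] would appear in this order, the middle step by
    separation, and the two links would cross. *)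
Lemma same_stack_reverses (i : 'I_s) (x y : G) :
  link x x \in P i ->
  link y y \in P i ->
  slt r (v, x) (v, y) -> slt r (u, y) (u, x).
Proof.
move=> xi yi lt.
have : ((u, x) : strong_product H G) != (u, y).
  by have := slt_neq lt; rewrite !xpair_eqE !eqxx.
case/(slt_total order_r) => // lt'.
case: (layout_P.2.2 i _ _ xi yi).
by exists (v, x), (u, x), (v, y), (u, y).
Qed.

Lemma twist_class_no_nest (p : 'I_s * 'I_s) (f g : {set G}) :
  f \in twist_class p -> g \in twist_class p -> ~ nest copy_order f g.
Proof.
move=> fp gp [a [b [x [y [ef eg [ax xy yb]]]]]]; subst f g.
have ab := slt_trans vertex_order_copy (slt_trans vertex_order_copy ax xy) yb.
have [b1 ab2] := twist_classP ab fp; have [y1 xy2] := twist_classP xy gp.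
rewrite !slt_copy_order in ax yb.
have by_ := same_stack_reverses y1 b1 yb.
(* The crossing order is [(v, a)], [(v, x)], [(u, b)], [(u, y)]. *)
by apply: (layout_P.2.2 _ _ _ ab2 xy2); exists (v, a), (u, b), (v, x), (u, y).
Qed.

Lemma card_stack_pairs : s ^ 2 = #|{: 'I_s * 'I_s}|.
Proof. by rewrite card_prod !card_ord. Qed.

(** Queue partitions are indexed by ordinals, so the pairs of stacks are enumerated. *)
Definition twist_queue (k : 'I_(s ^ 2)) : {set {set G}} :=
  twist_class (enum_val (cast_ord card_stack_pairs k)).

Lemma queue_partition_copy : queue_partition copy_order twist_queue.
Proof.
split; last by move=> k; apply: twist_class_no_nest.
split.
  apply/setP => e; apply/bigcupP/idP => [[k _]|]; first by rewrite inE => /andP[].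
  case/twist_class_cover=> p ep.
  exists (cast_ord (esym card_stack_pairs) (enum_rank p)) => //.
  by rewrite /twist_queue cast_ordKV enum_rankK.
move=> i j nij; rewrite -setI_eq0; apply/set0Pn => -[e /setIP[ei ej]].
by rewrite (cast_ord_inj (enum_val_inj (twist_class_inj ei ej))) eqxx in nij.
Qed.

Lemma separated_simultaneous_layout : has_simultaneous_layout G s (s ^ 2).
Proof.
exists copy_order, copy_stack, twist_queue; split.
- exact: vertex_order_copy.
- exact: stack_partition_copy.
- exact: queue_partition_copy.
Qed.

End SeparatedLayout.

Theorem theorem3 (G : sgraph) (n s : nat) :
  has_separated_stack_layout n G s ->
  has_simultaneous_layout G s (s ^ 2) /\ pathwidth G <= 2 * s ^ 3.
Proof.
case=> r [P [layout_P [v [u [adj_vu v_before_u]]]]].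
have simG := separated_simultaneous_layout layout_P adj_vu v_before_u.
(* Here [s ^ 3] is split as [s * s ^ 2], stacks times queues. *)
by split=> //; rewrite expnS; apply: simultaneous_layout_pathwidth.
Qed.
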